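(* Let $T \in \mathcal{B}(\mathcal{H})$. Then for any Orlicz function $\phi$ and for every $n \in \mathbb{N}$ (with $n\ge 1$), \begin{align*} \phi \left(w^n(T)\right) &\leq \frac{1}{2^{n-1}}\, \phi \left(w(T^n)\right) + \sum_{k=1}^{n-1} \frac{1}{2^k}\, \phi \left(\|T^k\|\|T\|^{n-k}\right)\\ &\leq \frac{1}{2^{n-1}}\, \phi \left(w(T^n)\right) + \left( 1-\frac{1}{2^{n-1}}\right) \phi \left(\|T\|^n\right). \end{align*}
   Context: $\mathcal{B}(\mathcal{H})$ is the algebra of bounded linear operators on a complex Hilbert space $\mathcal{H}$. For $T\in\mathcal{B}(\mathcal{H})$, $\|T\|$ is the operator norm, $w(T)=\sup_{\|x\|=1}|\langle Tx,x\rangle|$ is the numerical radius, and $w^n(T)=(w(T))^n$. An Orlicz function is a continuous, convex, increasing function $\phi:[0,\infty)\to[0,\infty)$ with $\phi(0)=0$, $\phi(t)>0$ for all $t>0$, and $\lim_{t\to\infty}\phi(t)=\infty$. *)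

(* Defs.v *)
From HB Require Import structures.
From mathcomp Require Import all_boot all_order all_algebra.
From mathcomp Require Import all_classical all_reals all_analysis.
From mathcomp Require Import complex.

Set Implicit Arguments.
Unset Strict Implicit.
Unset Printing Implicit Defensive.

Import Order.TTheory GRing.Theory Num.Theory.
Import numFieldNormedType.Exports.

Local Open Scope classical_set_scope.
Local Open Scope ring_scope.
Local Open Scope complex_scope.

(* The inner product is linear in its first argument and conjugate-linear in
   its second one. *)
HB.mixin Record CompleteNormedModule_isHilbert (R : realType) H
    of CompleteNormedModule R[i] H := {
  inner : {dot H for (@Num.conj R[i])} ;
  normr_inner : forall x : H, `|x| ^+ 2 = inner x x
}.

#[short(type="hilbertType")]
HB.structure Definition Hilbert (R : realType) :=
  {H of CompleteNormedModule R[i] H & CompleteNormedModule_isHilbert R H}.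

Section Operators.
Context {R : realType} {H : hilbertType R}.
Implicit Types T : H -> H.

(* Norms and moduli are elements of R[i], whose order is partial; the suprema
   are taken in R. *)
Definition hnorm (x : H) : R := complex.Re `|x|.

Definition bounded_operator T := exists M : R, forall x, hnorm (T x) <= M * hnorm x.

Definition opnorm T : R := sup [set hnorm (T x) | x in [set x | hnorm x <= 1]].

(* If H = 0, the set is empty and its supremum is 0. *)
Definition numerical_radius T : R :=
  sup [set complex.Re `|inner (T x) x| | x in [set x | hnorm x = 1]].

End Operators.

(* Only the values of phi on the half-line of nonnegative reals matter. *)
Record orlicz_function (R : realType) (phi : R -> R) : Prop := OrliczFunction {
  orlicz_ge0 : forall t : R, 0 <= t -> 0 <= phi t ;
  orlicz_continuous : {within `[0, +oo[, continuous phi} ;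
  orlicz_convex : convex_function (`[0, +oo[%classic : set R^o) phi ;
  orlicz_nondecreasing : {in `[0, +oo[ &, {homo phi : s t / s <= t}} ;
  orlicz0 : phi 0 = 0 ;
  orlicz_gt0 : forall t : R, 0 < t -> 0 < phi t ;
  orlicz_cvgy : phi t @[t --> +oo] --> +oo
}.

(* Main.v *)
(* For a unit vector e, the map a |-> 2<a,e>e - a is an isometry. Applying T to
   <a,e>e = (a + (2<a,e>e - a))/2 gives the Buzano-type bound
     |<a,e>| |<Te,e>| <= (|<Ta,e>| + ||T|| ||a||)/2
   without any adjoint. With a = T^k e it yields
     |<T^k e,e>| |<Te,e>| <= (|<T^(k+1) e,e>| + ||T^k|| ||T||)/2,
   and iterating from k = 1, bounding the leftover powers of |<Te,e>| by
   powers of ||T||, produces the inequality for phi = id. Its right-hand side is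
   a dyadic convex combination, so Jensen's inequality finishes. *)
Require Import Defs.
From mathcomp Require Import all_boot all_order all_algebra.
From mathcomp Require Import all_classical all_reals all_analysis.
From mathcomp Require Import complex.
From mathcomp Require Import ring lra.
Import Order.TTheory GRing.Theory Num.Theory.
Import numFieldNormedType.Exports.
Local Open Scope ring_scope.
Local Open Scope complex_scope.

Set Implicit Arguments.
Unset Strict Implicit.
Unset Printing Implicit Defensive.

(** The root of order [n.+1] of [C] is an upper bound of [A]. If [A] is empty, as for the unit
    sphere of a zero space, its supremum is 0 and [0 <= C] suffices. *)
Lemma sup_exp_le (R : realType) (A : set R) (n : nat) (C : R) :
  0 <= C -> (forall x, A x -> 0 <= x) -> (forall x, A x -> x ^+ n.+1 <= C) ->
  sup A ^+ n.+1 <= C.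
Proof.
move=> C0 A0 AC.
have [->|/set0P[x0 Ax0]] := eqVneq A set0; first by rewrite sup0 expr0n.
set r := C `^ (n.+1%:R^-1).
have rC : r ^+ n.+1 = C.
  by rewrite -powR_mulrn ?powR_ge0 // -powRrM mulVf ?pnatr_eq0 // powRr1.
have Ar x : A x -> x <= r.
  by move=> Ax; rewrite -(@ler_pXn2r _ n.+1) ?nnegrE ?powR_ge0 ?A0 // rC AC.
rewrite -rC lerXn2r ?nnegrE ?powR_ge0 //; last by apply: ge_sup => //; exists x0.
by apply: le_trans (A0 _ Ax0) _; apply: ub_le_sup => //; exists r.
Qed.


(** * Dyadic averages: Jensen's inequality and a recurrence for real sequences *)

Section Orlicz.
Context {R : realType} {phi : R -> R} (hphi : orlicz_function phi).

Lemma orlicz_midpoint (x y : R) : 0 <= x -> 0 <= y ->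
  phi ((x + y) / 2) <= (phi x + phi y) / 2.
Proof.
move=> x0 y0.
have h0 : 0 <= (2^-1 : R) by lra.
have h1 : (2^-1 : R) <= 1 by lra.
have mem (z : R) : 0 <= z -> z \in (`[0, +oo[%classic : set R^o).
  by move=> z0; rewrite inE /= in_itv /= z0.
have avg (u v : R) : (u + v) / 2 = 2^-1 * u + (1 - 2^-1) * v by field.
rewrite !avg; exact: (orlicz_convex hphi (Itv01 h0 h1) (mem _ x0) (mem _ y0)).
Qed.

Lemma le_orlicz (x y : R) : 0 <= x -> x <= y -> phi x <= phi y.
Proof.
move=> x0 xy; apply: (orlicz_nondecreasing hphi) => //.
  by rewrite in_itv /= x0.
by rewrite in_itv /= (le_trans x0 xy).
Qed.

(** The two smallest weights are equal, so their terms merge into one midpoint of doubled weight.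
    Midpoint convexity thus suffices, by induction with [a] replaced by [(a + b m.+1) / 2]. *)
Lemma orlicz_dyadic (a : R) (b : nat -> R) (m : nat) :
  0 <= a -> (forall k, 0 <= b k) ->
  phi (1 / 2 ^+ m * a + \sum_(1 <= k < m.+1) 1 / 2 ^+ k * b k)
    <= 1 / 2 ^+ m * phi a + \sum_(1 <= k < m.+1) 1 / 2 ^+ k * phi (b k).
Proof.
move=> a0 b0; elim: m a a0 => [|m IHm] a a0.
  by rewrite !big_geq // expr0 divr1 !mul1r !addr0.
have c0 : 0 <= (a + b m.+1) / 2 by rewrite divr_ge0 ?addr_ge0.
rewrite !(@big_nat_recr _ _ _ m.+1) //=.
have tail (u v S : R) :
    1 / 2 ^+ m.+1 * u + (S + 1 / 2 ^+ m.+1 * v) = 1 / 2 ^+ m * ((u + v) / 2) + S.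
  by rewrite exprS; field; rewrite expf_neq0.
rewrite !tail; apply: le_trans (IHm _ c0) _.
by rewrite lerD2r ler_pM2l ?divr_gt0 ?exprn_gt0 // orlicz_midpoint.
Qed.

End Orlicz.

(** Here [a k] stands for |<T^k e,e>|, [b k] for ||T^k|| and [c] for ||T||. Each induction step
    multiplies by [a 1]: the recurrence splits the leading term, and in the sum the new factor is
    bounded by [c]. *)
Lemma exp_dyadic_le (R : realFieldType) (a b : nat -> R) (c : R) (m : nat) :
  (forall k, 0 <= b k) -> 0 <= a 1%N <= c ->
  (forall k, a k.+1 * a 1%N <= (a k.+2 + b k.+1 * c) / 2) ->
  a 1%N ^+ m.+1 <= 1 / 2 ^+ m * a m.+1
    + \sum_(1 <= k < m.+1) 1 / 2 ^+ k * (b k * c ^+ (m.+1 - k)).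
Proof.
move=> b0 /andP[a0 ac] ab; have c0 := le_trans a0 ac.
elim: m => [|m IHm]; first by rewrite big_geq // expr0 divr1 mul1r addr0 expr1.
rewrite exprSr big_nat_recr //= subSnn expr1.
apply: le_trans (ler_wpM2r a0 IHm) _.
(* Pairs the old sum with the summands [k <= m], and the leading term with the new leading term plus
   the summand [k = m.+1]. *)
rewrite mulrDl [leLHS]addrC [leRHS]addrCA; apply: lerD.
  rewrite mulr_suml big_seq [leRHS]big_seq; apply: ler_sum => k.
  rewrite mem_index_iota => /andP[_ km].
  rewrite -[leLHS]mulrA; apply: ler_wpM2l; first by rewrite divr_ge0 ?exprn_ge0.
  rewrite -mulrA; apply: ler_wpM2l => //.
  by rewrite (subSn (ltnW km)) exprSr; apply: ler_wpM2l; rewrite ?exprn_ge0.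
rewrite -mulrDr -[leLHS]mulrA.
have -> : 1 / 2 ^+ m.+1 * (a m.+2 + b m.+1 * c) =
    1 / 2 ^+ m * ((a m.+2 + b m.+1 * c) / 2).
  by rewrite exprS; field; rewrite expf_neq0.
by rewrite ler_pM2l ?divr_gt0 ?exprn_gt0.
Qed.

Lemma sum_inv_exp2 (R : numFieldType) (m : nat) :
  \sum_(1 <= k < m.+1) 1 / 2 ^+ k = 1 - 1 / 2 ^+ m :> R.
Proof.
elim: m => [|m IHm]; first by rewrite big_geq // expr0 divr1 subrr.
by rewrite big_nat_recr //= IHm exprS; field; rewrite expf_neq0.
Qed.

(** * Reflections, Cauchy-Schwarz and the Buzano-type bound *)

Section Hilbert.
Context {R : realType} {H : hilbertType R}.
Implicit Types (x y a e : H).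

Lemma hnormC x : (hnorm x)%:C = `|x|.
Proof. by rewrite RRe_real // ger0_real. Qed.

Lemma normc_ReC (z : R[i]) : (complex.Re `|z|)%:C = `|z|.
Proof. by rewrite RRe_real // ger0_real. Qed.

Lemma hnorm_ge0 x : 0 <= hnorm x.
Proof. by rewrite -ler0c hnormC. Qed.

Lemma hnormZ (c : R) x : 0 <= c -> hnorm (c%:C *: x) = c * hnorm x.
Proof.
move=> c0; apply: complexI.
by rewrite hnormC normrZ rmorphM /= hnormC ger0_norm ?ler0c.
Qed.

(** In the expansion of the squared norm, the term 4|<a,e>|^2 cancels against the cross terms. *)
Lemma norm_reflect e a : `|e| = 1 -> `|2 *: (inner a e *: e) - a| = `|a|.
Proof.
move=> e1; have ee : inner e e = 1 by rewrite -normr_inner e1 expr1n.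
apply/eqP; rewrite -(eqrXn2 (n := 2)) // !normr_inner; apply/eqP.
rewrite dnormB /= !dnormZ ee !linearZl_LR /= (hermC _ e a) /= expr0 mul1r.
rewrite !rmorphM /= conjCK !normCK conjC_nat.
ring.
Qed.

(** Cauchy-Schwarz from the triangle inequality: 2<a,e>e is the sum of [a] and its reflection, which
    have equal norms. *)
Lemma inner_unit_le e a : `|e| = 1 -> `|inner a e| <= `|a|.
Proof.
move=> e1; rewrite -(@ler_pM2l _ 2) //.
have -> : 2 * `|inner a e| = `|2 *: (inner a e *: e) - a + a|.
  by rewrite subrK !normrZ e1 mulr1 normr_nat.
by rewrite (le_trans (ler_normD _ _)) // norm_reflect // mulr_natl.
Qed.

Lemma buzano (T : {linear H -> H}) (M : R) e a : 0 <= M ->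
  (forall x, hnorm (T x) <= M * hnorm x) -> hnorm e = 1 ->
  complex.Re `|inner a e| * complex.Re `|inner (T e) e|
    <= (complex.Re `|inner (T a) e| + M * hnorm a) / 2.
Proof.
move=> M0 TM he; have e1 : `|e| = 1 by rewrite -hnormC he.
set r := 2 *: (inner a e *: e) - a.
have Tr : T r = 2 *: (inner a e *: T e) - T a.
  by rewrite /r linearB linearZZ linearZZ.
have : `|inner a e| * `|inner (T e) e| *+ 2 <= `|inner (T a) e| + M%:C * `|a|.
  have -> : `|inner a e| * `|inner (T e) e| *+ 2 = `|inner (T a + T r) e|.
    by rewrite Tr addrC subrK !linearZl_LR !normrM normr_nat mulr_natl.
  (* Only the [T r] term is estimated by norms; <Ta,e> is kept to feed the iteration. *)
  rewrite linearDl (le_trans (ler_normD _ _)) // lerD2l.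
  apply: le_trans (inner_unit_le _ e1) _.
  by rewrite -(norm_reflect a e1) -/r -!hnormC -rmorphM lecR.
rewrite -(normc_ReC (inner a e)) -(normc_ReC (inner (T e) e)).
rewrite -(normc_ReC (inner (T a) e)) -hnormC -!rmorphM -rmorphMn -rmorphD lecR.
by rewrite ler_pdivlMr // mulr_natr.
Qed.

End Hilbert.

(** * Operator norm and numerical radius *)

Section Opnorm.
Context {R : realType} {H : hilbertType R}.
Implicit Types (x y : H).

Section Scalable.
Variable T : H -> H.
Hypotheses (sT : scalable T) (bT : bounded_operator T).

Let T0 : T 0 = 0.
Proof. by rewrite -[X in T X](scale0r 0) sT scale0r. Qed.

Let has_ubT :
  has_ubound [set hnorm (T x) | x in [set x : H | hnorm x <= 1]]%classic.
Proof.
case: bT => M TM; exists `|M| => _ [x /= x1 <-].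
apply: le_trans (TM x) _; apply: le_trans (ler_norm _) _.
by rewrite normrM (ger0_norm (hnorm_ge0 _)) ler_piMr.
Qed.

Lemma opnorm_ge0 : 0 <= opnorm T.
Proof.
apply: le_trans (hnorm_ge0 (T 0)) _; apply: ub_le_sup => //.
(* Unlike the unit sphere, the unit ball is never empty: it contains 0. *)
by exists 0 => //=; rewrite /hnorm normr0 /= ler01.
Qed.

Lemma hnorm_le_opnorm x : hnorm (T x) <= opnorm T * hnorm x.
Proof.
have [->|x0] := eqVneq x 0; first by rewrite T0 /hnorm normr0 /= mulr0.
have hx : 0 < hnorm x by rewrite -ltcR hnormC normr_gt0.
rewrite -ler_pdivrMr // mulrC -hnormZ ?invr_ge0 ?hnorm_ge0 // -sT.
apply: ub_le_sup => //; exists ((hnorm x)^-1%:C *: x) => //=.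
by rewrite hnormZ ?invr_ge0 ?hnorm_ge0 // mulVf // gt_eqF.
Qed.

Lemma opnorm_le (M : R) :
  0 <= M -> (forall x, hnorm (T x) <= M * hnorm x) -> opnorm T <= M.
Proof.
move=> M0 TM; apply: ge_sup.
  by exists (hnorm (T 0)); exists 0 => //=; rewrite /hnorm normr0 /= ler01.
by move=> _ [x /= x1 <-]; apply: le_trans (TM x) _; rewrite ler_piMr.
Qed.

Lemma le_numerical_radius x : hnorm x = 1 ->
  complex.Re `|inner (T x) x| <= numerical_radius T.
Proof.
move=> x1; apply: ub_le_sup; last by exists x.
exists (opnorm T) => _ [y /= y1 <-].
have y1C : `|y| = 1 by rewrite -hnormC y1.
rewrite -lecR normc_ReC (le_trans (inner_unit_le _ y1C)) // -hnormC lecR.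
by rewrite -[leRHS]mulr1 -y1 hnorm_le_opnorm.
Qed.

End Scalable.

Lemma numerical_radius_ge0 (T : H -> H) : scalable T -> bounded_operator T ->
  0 <= numerical_radius T.
Proof.
move=> sT bT; rewrite /numerical_radius.
set A := (X in sup X); have [->|/set0P[_ [x x1 _]]] := eqVneq A set0.
  by rewrite sup0.
by apply: le_trans (le_numerical_radius sT bT x1); rewrite -ler0c normc_ReC.
Qed.

(** * Powers of a bounded operator *)

Section Iter.
Variable T : {linear H -> H}.
Hypothesis bT : bounded_operator T.

(** [iter k T] is a bare function; homogeneity is what the preceding norm bounds ask of it. *)
Lemma scalable_iter k : scalable (iter k T).
Proof. by elim: k => [|k IHk] c x //=; rewrite IHk linearZZ. Qed.

Lemma hnorm_iter_le k x : hnorm (iter k T x) <= opnorm T ^+ k * hnorm x.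
Proof.
elim: k => [|k IHk]; first by rewrite expr0 mul1r.
have sT : scalable T by move=> c y; rewrite linearZZ.
rewrite iterS exprS -mulrA; apply: le_trans (hnorm_le_opnorm sT bT _) _.
by rewrite ler_wpM2l ?opnorm_ge0.
Qed.

Lemma bounded_iter k : bounded_operator (iter k T).
Proof. by exists (opnorm T ^+ k); exact: hnorm_iter_le. Qed.

Lemma opnorm_iter_le k : opnorm (iter k T) <= opnorm T ^+ k.
Proof.
have T0 : 0 <= opnorm T by exact: opnorm_ge0.
by apply: opnorm_le; [exact: exprn_ge0|exact: hnorm_iter_le].
Qed.

Lemma opnorm_iter_ge0 k : 0 <= opnorm (iter k T).
Proof. exact: opnorm_ge0 (bounded_iter k). Qed.

(** Stated for a fixed unit vector, since the recurrence links the values <T^k x,x> at one and the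
    same [x]; the supremum is taken afterwards. *)
Lemma exp_inner_le x m : hnorm x = 1 ->
  complex.Re `|inner (T x) x| ^+ m.+1
    <= 1 / 2 ^+ m * complex.Re `|inner (iter m.+1 T x) x|
       + \sum_(1 <= k < m.+1)
           1 / 2 ^+ k * (opnorm (iter k T) * opnorm T ^+ (m.+1 - k)).
Proof.
move=> x1; have x1C : `|x| = 1 by rewrite -hnormC x1.
have Tle y : hnorm (T y) <= opnorm T * hnorm y.
  by rewrite -[opnorm T]expr1 (hnorm_iter_le 1).
apply: (@exp_dyadic_le _ (fun k => complex.Re `|inner (iter k T x) x|)
  (fun k => opnorm (iter k T)) (opnorm T)).
- exact: opnorm_iter_ge0.
- apply/andP; split; first by rewrite -ler0c normc_ReC.
  rewrite -lecR normc_ReC (le_trans (inner_unit_le _ x1C)) // -hnormC lecR.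
  by rewrite -[leRHS]mulr1 -x1 Tle.
(* The bound is used with [a] = T^(k+1) x; [iter 1 T] is [T] by computation. *)
- move=> k; apply: le_trans (buzano _ (opnorm_iter_ge0 1) Tle x1) _.
  rewrite ler_pM2r ?invr_gt0 // lerD2l mulrC; apply: ler_wpM2r.
    exact: (opnorm_iter_ge0 1).
  rewrite -[leRHS]mulr1 -x1.
  exact: (hnorm_le_opnorm (@scalable_iter k.+1) (bounded_iter k.+1)).
Qed.

End Iter.
End Opnorm.

Local Close Scope complex_scope.

Theorem theorem2p28 (R : realType) (H : hilbertType R) (T : {linear H -> H})
    (hT : bounded_operator T) (phi : R -> R) (hphi : orlicz_function phi)
    (n : nat) (hn : (1 <= n)%N) :
  phi (numerical_radius T ^+ n)
    <= 1 / 2 ^+ (n - 1) * phi (numerical_radius (iter n T))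
       + \sum_(1 <= k < n)
           1 / 2 ^+ k * phi (opnorm (iter k T) * opnorm T ^+ (n - k))
    <= 1 / 2 ^+ (n - 1) * phi (numerical_radius (iter n T))
       + (1 - 1 / 2 ^+ (n - 1)) * phi (opnorm T ^+ n).
Proof.
case: n hn => // m _; rewrite subn1 /=.
have w_ge0 k : 0 <= numerical_radius (iter k T).
  exact: numerical_radius_ge0 (scalable_iter T k) (bounded_iter hT k).
have T0 : 0 <= opnorm T := opnorm_iter_ge0 hT 1.
have b_ge0 k : 0 <= opnorm (iter k T) * opnorm T ^+ (m.+1 - k).
  by rewrite mulr_ge0 ?exprn_ge0 ?opnorm_iter_ge0.
have dyadic_ge0 k : 0 <= 1 / 2 ^+ k :> R by rewrite divr_ge0 ?exprn_ge0.
apply/andP; split.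
  (* Jensen and then monotonicity remove [phi], leaving a bound on each |<Tx,x>|^(m+1) over the unit
     sphere. *)
  apply: le_trans (orlicz_dyadic hphi m (w_ge0 m.+1) b_ge0).
  apply: le_orlicz => //; first exact: exprn_ge0 (w_ge0 1).
  apply: sup_exp_le.
  - by rewrite addr_ge0 ?mulr_ge0 // sumr_ge0 // => k _; rewrite mulr_ge0.
  - by move=> _ [x _ <-]; rewrite -ler0c normc_ReC.
  move=> _ [x /= x1 <-]; apply: le_trans (exp_inner_le hT m x1) _.
  rewrite lerD2r ler_wpM2l //.
  exact: (le_numerical_radius (scalable_iter T _) (bounded_iter hT m.+1) x1).
(* Writing the coefficient as the sum of the weights 1/2^k reduces the claim termwise to ||T^k||
   ||T||^(n-k) <= ||T||^n. *)
rewrite lerD2l -sum_inv_exp2 mulr_suml big_seq [leRHS]big_seq.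
apply: ler_sum => k; rewrite mem_index_iota => /andP[_ km].
rewrite ler_wpM2l // le_orlicz // -[X in _ <= _ ^+ X](subnKC (ltnW km)) exprD.
by rewrite ler_wpM2r ?exprn_ge0 ?opnorm_iter_le.
Qed.
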